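(* Let $B=K_{1,1,2}$. Then $f_B(\gamma)\le\gamma^{2-o(1)}$, where the $o(1)$ term goes to $0$ as $\gamma\to 0$. That is, for every $\varepsilon>0$ there is $\gamma_0>0$ such that $f_B(\gamma)\le\gamma^{2-\varepsilon}$ for all $0<\gamma<\gamma_0$.
   Context: Graphs are finite and simple. For a fixed graph $H$ on $h$ vertices and a graph $G$ on $n$ vertices, $Hom_H(G)$ is the number of homomorphisms from $H$ to $G$, i.e. (not necessarily injective) mappings $V(H)\to V(G)$ which map edges of $H$ to edges of $G$. The $H$-density of $G$ is $d_H(G)=Hom_H(G)/n^h$. $K_{a,b,c}$ denotes the complete 3-partite graph with parts of sizes $a,b,c$ (the $(a,b,c)$-blowup of the triangle $K_3$). Densities are understood asymptotically (up to $o(1)$ as the number of vertices tends to infinity). For $B=K_{a,b,c}$ and $0<\gamma<1$, $f_B(\gamma)$ denotes the infimum of the asymptotic $B$-density over all graphs with asymptotic triangle density $\gamma$. Precisely, $f_B(\gamma)$ is the infimum of all $\beta$ for which there is a sequence of graphs $(G_i)$ with $|V(G_i)|\to\infty$, $d_{K_3}(G_i)\to\gamma$ and $d_B(G_i)\to\beta$. *)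

(* Defs.v *)
From mathcomp Require Import all_boot all_order all_algebra.
From mathcomp Require Import all_classical all_reals all_analysis.

Set Implicit Arguments.
Unset Strict Implicit.
Unset Printing Implicit Defensive.

Import Order.TTheory GRing.Theory Num.Theory.
Import numFieldNormedType.Exports.

Local Open Scope classical_set_scope.
Local Open Scope ring_scope.

Record sgraph := SGraph {
  vertex :> finType;
  adj : rel vertex;
  adj_sym : symmetric adj;
  adj_irrefl : irreflexive adj }.

Definition is_hom (H G : sgraph) (f : {ffun H -> G}) : bool :=
  [forall x, forall y, adj x y ==> adj (f x) (f y)].

Definition homs (H G : sgraph) : nat := #|[pred f : {ffun H -> G} | is_hom f]|.

Definition density (R : realType) (H G : sgraph) : R :=
  (homs H G)%:R / #|G|%:R ^+ #|H|.

Section Complete.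
Variable n : nat.

Definition complete_adj : rel 'I_n := fun i j => i != j.

Lemma complete_adj_sym : symmetric complete_adj.
Proof. by move=> i j; rewrite /complete_adj eq_sym. Qed.

Lemma complete_adj_irrefl : irreflexive complete_adj.
Proof. by move=> i; rewrite /complete_adj eqxx. Qed.

Definition complete : sgraph := SGraph complete_adj_sym complete_adj_irrefl.
End Complete.

Section CompleteTripartite.
Variables a b c : nat.

Definition part (x : 'I_a + 'I_b + 'I_c) : 'I_3 :=
  match x with
  | inl (inl _) => inord 0
  | inl (inr _) => inord 1
  | inr _ => inord 2
  end.

Definition tripartite_adj : rel ('I_a + 'I_b + 'I_c)%type :=
  fun x y => part x != part y.

Lemma tripartite_adj_sym : symmetric tripartite_adj.
Proof. by move=> x y; rewrite /tripartite_adj eq_sym. Qed.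

Lemma tripartite_adj_irrefl : irreflexive tripartite_adj.
Proof. by move=> x; rewrite /tripartite_adj eqxx. Qed.

Definition complete_tripartite : sgraph :=
  SGraph tripartite_adj_sym tripartite_adj_irrefl.
End CompleteTripartite.

Definition attainable (R : realType) (B : sgraph) (gamma : R) : set R :=
  [set beta | exists G : nat -> sgraph,
    [/\ (fun i => #|G i|) @ \oo --> \oo,
        (fun i => density R (complete 3) (G i)) @ \oo --> gamma &
        (fun i => density R B (G i)) @ \oo --> beta]].

(* The infimum is taken in the extended reals, where the infimum of the empty
   set is +oo; the real-valued [inf] would silently return 0 there. *)
Definition min_density (R : realType) (B : sgraph) (gamma : R) : \bar R :=
  ereal_inf [set beta%:E | beta in attainable B gamma].

(* Main.v *)
Require Import Defs.
From mathcomp Require Import all_boot all_order all_algebra.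
From mathcomp Require Import all_classical all_reals all_analysis.
From mathcomp Require Import zify ring.

(** In a graph whose edges each lie in at most one triangle, a copy of K_{1,1,2}
    degenerates to a triangle, so it has at most as many K_{1,1,2}'s as K_3's.
    A dense such graph on n vertices, with n^{2-o(1)} triangles, comes from
    Behrend's idea in its lifted form: three classes (levels 0, 1, 2) of vertices
    (x, u), with x in a box of Z^d and u a height, where vertices of distinct
    levels p and p' are adjacent iff (p' - p)(u' - u) = |x' - x|^2.  Strict
    convexity of the paraboloid forces the points of a triangle to be collinear,
    so any two of its vertices determine the third one.
    Blowing this graph up and adding isolated vertices, so that the blown-up part
    is a proportion t of the whole, scales the two densities by t^4 and t^3: any
    smaller triangle density gamma is reached exactly, and the K_{1,1,2}-density
    is then at most t gamma / n <= gamma / n.  With side m of the box, the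
    triangle density is at least c_d m^{-(d+6)} whereas n >= m^d; taking m about
    (c_d / gamma)^{1/(d+6)} gives gamma / n = O(gamma^{2 - 6/(d+6)}). *)

Set Implicit Arguments.
Unset Strict Implicit.
Unset Printing Implicit Defensive.

Import Order.TTheory GRing.Theory Num.Theory.
Import numFieldNormedType.Exports.

Local Open Scope classical_set_scope.
Local Open Scope ring_scope.

(** * Homomorphisms into blow-ups padded with isolated vertices *)

Lemma is_homP (H K : sgraph) (f : {ffun H -> K}) :
  reflect (forall x y, adj x y -> adj (f x) (f y)) (is_hom f).
Proof.
apply: (iffP forallP) => [h x y|h x]; first by move/forallP: (h x) => /(_ y)/implyP.
by apply/forallP => y; apply/implyP/h.
Qed.

Section PaddedBlowup.
Variables (G : sgraph) (k r : nat).

Definition blowup_adj : rel (G * 'I_k + 'I_r)%type := fun x y =>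
  match x, y with
  | inl p, inl q => adj p.1 q.1
  | _, _ => false
  end.

Lemma blowup_adj_sym : symmetric blowup_adj.
Proof. by move=> [p|i] [q|j] //=; rewrite adj_sym. Qed.

Lemma blowup_adj_irrefl : irreflexive blowup_adj.
Proof. by move=> [p|i] //=; rewrite adj_irrefl. Qed.

Definition blowup : sgraph := SGraph blowup_adj_sym blowup_adj_irrefl.

Lemma card_blowup : #|blowup| = (#|G| * k + r)%N.
Proof. by rewrite card_sum card_prod !card_ord. Qed.

(** Every vertex of [H] has an edge, so a homomorphism avoids the isolated padding; it amounts to a
    homomorphism into [G] and a free choice of copy for each vertex of [H]. *)
Lemma homs_blowup (H : sgraph) : (forall x : H, exists y : H, adj x y) ->
  homs H blowup = (homs H G * k ^ #|H|)%N.
Proof.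
move=> Hnoiso; rewrite /homs.
pose phi (p : {ffun H -> G} * {ffun H -> 'I_k}) : {ffun H -> blowup} :=
  [ffun x => inl (p.1 x, p.2 x)].
have phi_inj : injective phi.
  move=> [f g] [f' g'] /ffunP e; congr pair; apply/ffunP => x;
  by have := e x; rewrite !ffunE => -[].
transitivity #|phi @: finset.setX [set f : {ffun H -> G} | is_hom f]%SET
                          [set: {ffun H -> 'I_k}]%SET|.
  apply: eq_card => f; apply/idP/imsetP; last first.
    case=> -[g h]; rewrite !inE andbT /= => /is_homP gh ->.
    by apply/is_homP => x y /gh; rewrite !ffunE.
  rewrite inE => /is_homP fh.
  have fl x : {p : G * 'I_k | f x = inl p}.
    case e: (f x) => [p|i]; first by exists p.
    by exfalso; have [y /fh] := Hnoiso x; rewrite e.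
  exists ([ffun x => (sval (fl x)).1], [ffun x => (sval (fl x)).2]).
    rewrite !inE andbT /=; apply/is_homP => x y /fh; rewrite !ffunE.
    by case: (fl x) (fl y) => [p /= ep] [q /= eq]; rewrite ep eq.
  by apply/ffunP => x; rewrite !ffunE -surjective_pairing; apply: (svalP (fl x)).
by rewrite card_imset // cardsX cardsT card_ffun card_ord cardsE.
Qed.
End PaddedBlowup.

(** * The two pattern graphs, and K_{1,1,2} against triangles *)

Lemma complete_no_isolated n (x : complete n.+2) : exists y : complete n.+2, adj x y.
Proof.
case: (eqVneq x ord0) => [->|x0]; last by exists ord0.
by exists ord_max.
Qed.

Lemma K112_no_isolated (x : complete_tripartite 1 1 2) :
  exists y : complete_tripartite 1 1 2, adj x y.
Proof.
case: x => [[i|i]|i].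
- by exists (inr ord0); rewrite /= /tripartite_adj /= -val_eqE /= !inordK.
- by exists (inr ord0); rewrite /= /tripartite_adj /= -val_eqE /= !inordK.
- by exists (inl (inl ord0)); rewrite /= /tripartite_adj /= -val_eqE /= !inordK.
Qed.

Lemma card_K112 : #|complete_tripartite 1 1 2| = 4%N.
Proof. by rewrite !card_sum !card_ord. Qed.

Definition unique_common_neighbour (K : sgraph) :=
  forall s t r r' : K, adj s t -> adj s r -> adj t r -> adj s r' -> adj t r' -> r = r'.

(** The two vertices of the part of size 2 are sent to common neighbours of one edge, hence to the
    same vertex, so restriction to one triangle is injective on homomorphisms. *)
Lemma homs_K112_le (K : sgraph) : unique_common_neighbour K ->
  (homs (complete_tripartite 1 1 2) K <= homs (complete 3) K)%N.
Proof.
move=> Kuniq.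
pose B := complete_tripartite 1 1 2.
pose a : B := inl (inl ord0); pose b : B := inl (inr ord0).
pose c i : B := inr i.
pose psi (f : {ffun B -> K}) : {ffun complete 3 -> K} :=
  [ffun i : 'I_3 => if i == 0 :> nat then f a else if i == 1 :> nat then f b else f (c ord0)].
have part_ne (x y : B) : part x != part y -> adj x y by [].
have Eab : adj a b by apply: part_ne; rewrite /= -val_eqE /= !inordK.
have Eac i : adj a (c i) by apply: part_ne; rewrite /= -val_eqE /= !inordK.
have Ebc i : adj b (c i) by apply: part_ne; rewrite /= -val_eqE /= !inordK.
have psi_inj : {in [pred f : {ffun B -> K} | is_hom f] &, injective psi}.
  move=> f g /is_homP fh /is_homP gh /ffunP e.
  have ea : f a = g a by have := e (@Ordinal 3 0 isT); rewrite !ffunE.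
  have eb : f b = g b by have := e (@Ordinal 3 1 isT); rewrite !ffunE.
  have ec : f (c ord0) = g (c ord0) by have := e (@Ordinal 3 2 isT); rewrite !ffunE.
  have fc i : f (c i) = f (c ord0) by apply: (Kuniq (f a) (f b)); apply: fh.
  have gc i : g (c i) = g (c ord0) by apply: (Kuniq (g a) (g b)); apply: gh.
  apply/ffunP => -[[i|i]|i]; rewrite ?(ord1 i) //.
  by rewrite -/(c i) fc gc.
rewrite /homs -(card_in_image psi_inj) subset_leq_card //.
apply/fintype.subsetP => x /fintype.imageP[f fh ->]; apply/is_homP.
move/is_homP: fh => fh.
have sK u v : adj u v -> adj (f v) (f u) by rewrite adj_sym => /fh.
move=> i j; rewrite !ffunE.
by case: i j => [[|[|[|//]]] ?] [[|[|[|//]]] ?] //= _;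
  first [exact: fh | exact: sK].
Qed.

(** * The lifted Behrend graph *)

Section Behrend.
Variables d m : nat.

(** The ranges leave room for the points a + l b and the heights l |b|^2, with l <= 2 and
    coordinates of a, b below m. *)
Definition behrend_vertex : finType :=
  ('I_3 * ({ffun 'I_d -> 'I_(3 * m).+1} * 'I_(2 * d * m ^ 2).+1))%type.

Definition level (s : behrend_vertex) : int := (s.1 : nat)%:Z.
Definition point (s : behrend_vertex) (j : 'I_d) : int := (s.2.1 j : nat)%:Z.
Definition height (s : behrend_vertex) : int := (s.2.2 : nat)%:Z.

(** Dividing by the squared level difference: the slopes of the point and of the height form a point
    (v, |v|^2) of the paraboloid. *)
Definition behrend_adj : rel behrend_vertex := fun s t =>
  (s.1 != t.1) &&
  ((level t - level s) * (height t - height s)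
     == \sum_j (point t j - point s j) ^+ 2).

Lemma behrend_adj_sym : symmetric behrend_adj.
Proof.
move=> s t; rewrite /behrend_adj eq_sym; congr (_ && (_ == _)); first by ring.
by apply: eq_bigr => j _; ring.
Qed.

Lemma behrend_adj_irrefl : irreflexive behrend_adj.
Proof. by move=> s; rewrite /behrend_adj eqxx. Qed.

Definition behrend : sgraph := SGraph behrend_adj_sym behrend_adj_irrefl.

Lemma card_behrend :
  #|behrend| = (3 * ((3 * m).+1 ^ d * (2 * d * m ^ 2).+1))%N.
Proof. by rewrite !card_prod card_ffun !card_ord. Qed.

(* With [al] and [be] the level differences, the three edge equations combine to
   [\sum_i |be (t_i - s_i) - al (r_i - t_i)|^2 = 0], whatever the order of the levels. *)
Lemma triangle_collinear (s t r : behrend) j :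
  adj s t -> adj s r -> adj t r ->
  (level r - level t) * (point t j - point s j)
    = (level t - level s) * (point r j - point t j).
Proof.
move=> /andP[_ /eqP st] /andP[_ /eqP sr] /andP[_ /eqP tr].
set al := level t - level s in st *.
set be := level r - level t in tr *.
have ab : level r - level s = al + be by rewrite /al /be; ring.
rewrite ab in sr.
pose defect i := be * (point t i - point s i) - al * (point r i - point t i).
have def0 : \sum_i defect i ^+ 2 = 0.
  have e i : defect i ^+ 2 = (al + be) * be * (point t i - point s i) ^+ 2
      + (al + be) * al * (point r i - point t i) ^+ 2
      - al * be * (point r i - point s i) ^+ 2 by rewrite /defect; ring.
  rewrite (eq_bigr _ (fun i _ => e i)) big_split big_split /= sumrN -!mulr_sumr.
  by rewrite -st -sr -tr; ring.
have /psumr_eq0P : forall i, true -> 0 <= defect i ^+ 2 by move=> i _; exact: sqr_ge0.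
move=> /(_ def0 j isT)/eqP; rewrite expf_eq0 /= subr_eq0 => /eqP.
by [].
Qed.

Lemma behrend_unique_common_neighbour : unique_common_neighbour behrend.
Proof.
move=> s t r r' st sr tr sr' tr'.
have [/andP[nst _] /andP[nsr _] /andP[ntr etr]] := And3 st sr tr.
have [/andP[nsr' _] /andP[ntr' etr']] := conj sr' tr'.
(* There are only three levels and [s], [t] occupy two of them. *)
have lev : r.1 = r'.1.
  apply: val_inj => /=.
  by move: nst nsr ntr nsr' ntr'; rewrite -!val_eqE /=;
     case: (s.1) (t.1) (r.1) (r'.1) => [a ?] [b ?] [c ?] [e ?] /=; lia.
have levz : level r = level r' by rewrite /level lev.
have al0 : level t - level s != 0.
  by rewrite subr_eq0 /level eqz_nat eq_sym.
have be0 : level r - level t != 0.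
  by rewrite subr_eq0 /level eqz_nat eq_sym.
have pt j : point r j = point r' j.
  have := triangle_collinear j st sr tr; have := triangle_collinear j st sr' tr'.
  by rewrite -levz => -> /(mulfI al0)/addIr.
have ht : height r = height r'.
  have e : \sum_j (point r j - point t j) ^+ 2 = \sum_j (point r' j - point t j) ^+ 2.
    by apply: eq_bigr => j _; rewrite pt.
  move: etr etr'; rewrite -e -levz => /eqP <- /eqP /(mulfI be0)/addIr.
  by [].
rewrite (surjective_pairing r) (surjective_pairing r') lev; congr pair.
rewrite (surjective_pairing r.2) (surjective_pairing r'.2); congr pair.
  by apply/ffunP => j; apply: val_inj; case: (pt j).
by apply: val_inj; case: ht.
Qed.

(** Each pair (a, b) in the box [0, m)^d gives a triangle: the progression a, a + b, a + 2b on
    levels 0, 1, 2, at heights 0, |b|^2, 2|b|^2. *)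
Lemma homs_K3_behrend : (m ^ (2 * d) <= homs (complete 3) behrend)%N.
Proof.
pose nrm (a : {ffun 'I_d -> 'I_m}) := (\sum_j a j ^ 2)%N.
pose tri (p : {ffun 'I_d -> 'I_m} * {ffun 'I_d -> 'I_m}) :
    {ffun complete 3 -> behrend} :=
  [ffun l : 'I_3 => (l, ([ffun j => inord (p.1 j + l * p.2 j)],
                         inord (l * nrm p.2)))].
(* Both values are in range, so [inord] never falls back on its default. *)
have ptE p (l : 'I_3) j : point (tri p l) j = (p.1 j + l * p.2 j)%N%:Z.
  rewrite /point !ffunE /= inordK //.
  have := ltn_ord l; have := ltn_ord (p.1 j); have := ltn_ord (p.2 j); nia.
have htE p (l : 'I_3) : height (tri p l) = (l * nrm p.2)%N%:Z.
  rewrite /height !ffunE /= inordK //.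
  rewrite ltnS -mulnA; apply: leq_mul; first by rewrite -ltnS.
  rewrite -[X in (_ <= X * _)%N]card_ord -sum_nat_const; apply: leq_sum => j _.
  by rewrite leq_exp2r // ltnW.
have lvE p (l : 'I_3) : level (tri p l) = (l : nat)%:Z by rewrite /level ffunE.
(* Level 0 recovers a, then level 1 recovers b. *)
have tri_inj : injective tri.
  move=> p p' e.
  have q0 j : p.1 j = p'.1 j.
    have := ptE p ord0 j; rewrite e ptE /= !mul0n !addn0 => -[h].
    exact/val_inj.
  rewrite (surjective_pairing p) (surjective_pairing p'); congr pair.
    by apply/ffunP.
  apply/ffunP => j; have := ptE p (@Ordinal 3 1 isT) j.
  rewrite e ptE /= !mul1n q0 => -[] /addnI h; exact/val_inj.
rewrite mul2n -addnn expnD.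
have <- : #|tri @: [set: {ffun 'I_d -> 'I_m} * {ffun 'I_d -> 'I_m}]%SET| = (m ^ d * m ^ d)%N.
  by rewrite card_imset // cardsT card_prod card_ffun !card_ord.
rewrite /homs subset_leq_card //; apply/fintype.subsetP => _ /imsetP[p _ ->].
rewrite inE; apply/is_homP => l l' ll'.
apply/andP; split; first by rewrite !ffunE.
rewrite !lvE !htE /nrm; apply/eqP.
have sqE j : (point (tri p l') j - point (tri p l) j) ^+ 2
     = (l'%:Z - l%:Z) ^+ 2 * (p.2 j ^ 2)%N%:Z.
  by rewrite !ptE !PoszD !PoszM; ring.
rewrite (eq_bigr _ (fun j _ => sqE j)).
by rewrite -mulr_sumr -(big_morph Posz PoszD (erefl 0)) !PoszM; ring.
Qed.

End Behrend.

(** * Attaining a prescribed triangle density in the limit *)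

Lemma cvg_truncn_div (R : realType) (x : R) : 0 <= x ->
  (fun i : nat => (Num.truncn (x * i.+1%:R))%:R / i.+1%:R : R) @ \oo --> x.
Proof.
move=> x0; apply: (@squeeze_cvgr _ _ _ _ (fun i => x - harmonic i) (cst x)).
- near=> i; rewrite /harmonic /=.
  have /truncn_itv/andP[le_x gt_x] : 0 <= x * i.+1%:R by rewrite mulr_ge0.
  rewrite ler_pdivrMr // le_x andbT ler_pdivlMr // mulrBl mulVf // lerBlDr.
  by rewrite natr1 ltW.
- by rewrite -[X in _ --> X]subr0; apply: cvgB; [exact: cvg_cst|exact: cvg_harmonic].
- exact: cvg_cst.
Unshelve. all: by end_near. Qed.

Lemma cvg_exprn (R : realType) (u : nat -> R) (x : R) n :
  u @ \oo --> x -> (fun i => u i ^+ n) @ \oo --> x ^+ n.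
Proof.
move=> ux; elim: n => [|n IHn]; first by rewrite expr0; exact: cvg_cst.
rewrite exprS; under eq_fun do rewrite exprS.
exact: cvgM.
Qed.

Lemma attainable_blowup (R : realType) (B G : sgraph) (t : R) :
  (forall x : B, exists y : B, adj x y) -> (0 < #|G|)%N -> 0 <= t <= 1 ->
  attainable B (t ^+ 3 * density R (complete 3) G) (t ^+ #|B| * density R B G).
Proof.
move=> noisoB G0 /andP[t0 t1].
have Gpos : 0 < #|G|%:R :> R by rewrite ltr0n.
(* The limiting proportion of vertices taken by the copies of one vertex of [G]. *)
pose x : R := t / #|G|%:R.
have x0 : 0 <= x by rewrite divr_ge0 // ltW.
pose k i := Num.truncn (x * i.+1%:R).
have kG i : (#|G| * k i <= i.+1)%N.
  rewrite -(ler_nat R) natrM.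
  have /truncn_itv/andP[le_x _] : 0 <= x * i.+1%:R by rewrite mulr_ge0.
  apply: (le_trans (ler_wpM2l (ltW Gpos) le_x)).
  rewrite /x mulrA mulrCA divff ?gt_eqF // mulr1.
  by rewrite ler_piMl.
(* By [kG] the subtraction does not truncate, so [W i] has exactly i + 1 vertices. *)
pose W i := blowup G (k i) (i.+1 - #|G| * k i).
have cardW i : #|W i| = i.+1 by rewrite card_blowup subnKC.
have densW (H : sgraph) : (forall x : H, exists y : H, adj x y) ->
    (fun i => density R H (W i)) @ \oo --> t ^+ #|H| * density R H G.
  move=> noisoH.
  have -> : t ^+ #|H| * density R H G = (homs H G)%:R * x ^+ #|H|.
    by rewrite /density /x expr_div_n; ring.
  have -> : (fun i => density R H (W i)) =
      (fun i => (homs H G)%:R * ((k i)%:R / i.+1%:R) ^+ #|H|).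
    apply/funext => i; rewrite /density homs_blowup // cardW natrM natrX.
    by rewrite expr_div_n mulrA.
  apply: cvgM; first exact: cvg_cst.
  apply: cvg_exprn; exact: cvg_truncn_div.
exists W; split.
- under eq_fun do rewrite cardW -addn1.
  exact: cvg_addnr.
- have := densW (complete 3) (@complete_no_isolated 1).
  by rewrite {1}/complete /= card_ord.
- exact: densW.
Qed.

Lemma min_density_le (R : realType) (G : sgraph) (gamma : R) :
  unique_common_neighbour G -> (0 < #|G|)%N ->
  0 < gamma <= density R (complete 3) G ->
  (min_density (complete_tripartite 1 1 2) gamma <= (gamma / #|G|%:R)%:E)%E.
Proof.
move=> Guniq G0 /andP[gamma0 gammaG].
have Gpos : 0 < #|G|%:R :> R by rewrite ltr0n.
set g := density R (complete 3) G in gammaG.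
have g0 : 0 < g := lt_le_trans gamma0 gammaG.
have gg0 : 0 <= gamma / g by rewrite divr_ge0 // ltW.
(* Chosen so that t^3 g = gamma. *)
pose t : R := (gamma / g) `^ 3%:R^-1.
have t0 : 0 <= t by exact: powR_ge0.
have t3 : t ^+ 3 = gamma / g.
  by rewrite -powR_mulrn // /t -powRrM mulVf // powRr1.
have t1 : t <= 1.
  rewrite -(@expr_le1 _ 3) // t3 ler_pdivrMr // mul1r //.
have att : attainable (complete_tripartite 1 1 2) gamma
    (t ^+ 4 * density R (complete_tripartite 1 1 2) G).
  have := @attainable_blowup R _ G t K112_no_isolated G0.
  rewrite t0 t1 => /(_ isT); rewrite card_K112 t3 -/g.
  by rewrite divfK // gt_eqF.
apply: le_trans (ereal_inf_lbound _) _.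
  by exists (t ^+ 4 * density R (complete_tripartite 1 1 2) G).
rewrite lee_fin.
(* No more copies than triangles, but one more factor n in the denominator. *)
have dB : density R (complete_tripartite 1 1 2) G <= g / #|G|%:R.
  rewrite /g /density card_K112 card_ord -mulrA -invfM -exprSr.
  apply: ler_wpM2r; first by rewrite invr_ge0 exprn_ge0 // ltW.
  by rewrite ler_nat homs_K112_le.
apply: (le_trans (ler_wpM2l (exprn_ge0 4 t0) dB)).
have -> : t ^+ 4 * (g / #|G|%:R) = t * (gamma / #|G|%:R).
  by rewrite exprS t3; field; rewrite !gt_eqF.
by rewrite ler_piMl // divr_ge0 // ltW.
Qed.

(** * Size and triangle density of the Behrend graph *)

Lemma card_behrend_le d m : (0 < m)%N ->
  (#|behrend d m| <= 3 * 4 ^ d * (2 * d + 1) * m ^ (d + 2))%N.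
Proof.
move=> m0; rewrite card_behrend.
have le1 : ((3 * m).+1 ^ d <= 4 ^ d * m ^ d)%N.
  case: d => // d; rewrite -expnMn leq_exp2r //; lia.
have le2 : ((2 * d * m ^ 2).+1 <= (2 * d + 1) * m ^ 2)%N by nia.
rewrite expnD; have := leq_mul le1 le2; lia.
Qed.

Lemma card_behrend_ge d m : (m ^ d <= #|behrend d m|)%N.
Proof.
rewrite card_behrend.
have : (m ^ d <= (3 * m).+1 ^ d)%N by case: d => // d; rewrite leq_exp2r //; lia.
nia.
Qed.

(** At least m^{2d} triangles on at most c m^{d+2} vertices: the exponent is 3(d+2) - 2d = d + 6. *)
Lemma density_behrend_ge (R : realType) d m : (0 < m)%N ->
  ((3 * 4 ^ d * (2 * d + 1)) ^ 3 * m ^ (d + 6))%:R^-1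
    <= density R (complete 3) (behrend d m).
Proof.
move=> m0; set c := (3 * 4 ^ d * (2 * d + 1))%N.
have n0 : (0 < #|behrend d m|)%N.
  by apply: leq_trans (card_behrend_ge d m); rewrite expn_gt0 m0.
have c0 : (0 < c)%N by rewrite /c !muln_gt0 expn_gt0 addn1.
rewrite /density card_ord -natrX ler_pdivlMr; last by rewrite ltr0n expn_gt0 n0.
rewrite ler_pdivrMl; last by rewrite ltr0n muln_gt0 !expn_gt0 c0 m0.
rewrite -natrM ler_nat.
apply: (@leq_trans (c ^ 3 * m ^ (d + 6) * m ^ (2 * d))%N); last first.
  by rewrite leq_mul2l homs_K3_behrend orbT.
have -> : (c ^ 3 * m ^ (d + 6) * m ^ (2 * d) = (c * m ^ (d + 2)) ^ 3)%N.
  by rewrite expnMn -mulnA -expnD -expnM; congr (_ * _ ^ _)%N; lia.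
by rewrite leq_exp2r // card_behrend_le.
Qed.

(** * Choice of dimension and side *)

Theorem theorem4 (R : realType) (eps : R) (eps_gt0 : 0 < eps) :
  exists gamma0 : R, 0 < gamma0 /\
    forall gamma : R, 0 < gamma < gamma0 ->
      (min_density (complete_tripartite 1 1 2) gamma
         <= (gamma `^ (2 - eps))%:E)%E.
Proof.
pose d := Num.truncn (6 / eps).
pose D : R := (d + 6)%:R.
pose C : R := ((3 * 4 ^ d * (2 * d + 1)) ^ 3)%:R.
have D0 : 0 < D by rewrite ltr0n addn_gt0 orbT.
have C0 : 0 < C by rewrite ltr0n expn_gt0 !muln_gt0 expn_gt0 addn1.
(* The slack in the exponent, positive since 6/eps < d + 1 <= D; it will absorb the constant [K]. *)
pose delta := eps - 6 / D.
have delta0 : 0 < delta.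
  have /truncn_itv/andP[_ lt_d] : 0 <= 6 / eps by rewrite divr_ge0 // ltW.
  rewrite subr_gt0 ltr_pdivrMr // mulrC -ltr_pdivrMr //; apply: lt_le_trans lt_d _.
  by rewrite ler_nat addnS ltnS leq_addr.
pose e := d%:R / D.
have eE : e = 1 - eps + delta.
  rewrite /delta /e; have : D != 0 by rewrite gt_eqF.
  by rewrite /D natrD => ?; field.
pose K := 2 ^+ d * C `^ e.
have K0 : 0 < K by rewrite mulr_gt0 ?exprn_gt0 ?powR_gt0.
(* The first bound gives C gamma < 1, hence x >= 1 and m >= 1; the second gives K gamma^delta <=
   1. *)
exists (Num.min C^-1 (K^-1 `^ delta^-1)); split.
  by rewrite lt_min invr_gt0 C0 powR_gt0 // invr_gt0.
move=> gamma /andP[gamma0]; rewrite lt_min => /andP[gC gK].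
have Cg0 : 0 < C * gamma by rewrite mulr_gt0.
(* The real side at which the lower bound 1 / (C x^{d+6}) equals gamma; rounding down to [m] keeps
   the triangle density at least gamma. *)
pose x := (C * gamma)^-1 `^ D^-1.
have x0 : 0 <= x by exact: powR_ge0.
have xD : x ^+ (d + 6) = (C * gamma)^-1.
  by rewrite -powR_mulrn // /x -powRrM mulVf ?gt_eqF // powRr1 // invr_ge0 ltW.
have x1 : 1 <= x.
  rewrite -(@expr_ge1 _ (d + 6)) ?addn_gt0 ?orbT // xD.
  by rewrite -[leLHS]invr1 lef_pV2 ?posrE // -ler_pdivlMl // mulr1 ltW.
pose m := Num.truncn x.
have /andP[mx xm] := truncn_itv x0.
have m0 : (0 < m)%N by rewrite truncn_gt0.
have n0 : (0 < #|behrend d m|)%N.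
  by apply: leq_trans (card_behrend_ge d m); rewrite expn_gt0 m0.
apply: le_trans (min_density_le (@behrend_unique_common_neighbour d m) n0 _) _.
  rewrite gamma0; apply: le_trans (density_behrend_ge R d m0).
  rewrite natrM -/C natrX invfM -ler_pdivrMl ?invr_gt0 // invrK.
  rewrite -[leLHS]invrK -xD lef_pV2 ?posrE ?exprn_gt0 ?ltr0n //; last first.
    exact: lt_le_trans x1.
  by rewrite lerXn2r // nnegrE.
rewrite lee_fin.
have gammaD r s : gamma `^ (r + s) = gamma `^ r * gamma `^ s.
  by rewrite powRD // (gt_eqF gamma0) implybT.
have -> : 2 - eps = 1 + (1 - eps) by ring.
rewrite gammaD (powRr1 (ltW gamma0)).
have md0 : 0 < (m ^ d)%:R :> R by rewrite ltr0n expn_gt0 m0.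
apply: (@le_trans _ _ (gamma * (m ^ d)%:R^-1)).
  apply: (ler_wpM2l (ltW gamma0)).
  by rewrite lef_pV2 ?posrE // ?ltr0n // ler_nat card_behrend_ge.
have xd : (x ^+ d)^-1 = C `^ e * gamma `^ e.
  rewrite -powRM ?ltW // -powR_mulrn // /x -powRrM [D^-1 * _]mulrC.
  by rewrite -[X in X `^ (_ * _)]powR_inv1 ?ltW // -powRrM mulN1r powRN invrK.
(* As m >= 1, rounding loses at most a factor 2, whence the 2^d in [K]. *)
have x2m : x <= 2 * m%:R.
  apply: le_trans (ltW xm) _; rewrite -natrM ler_nat; lia.
apply: (ler_wpM2l (ltW gamma0)).
apply: (@le_trans _ _ (2 ^+ d * (x ^+ d)^-1)).
  have xd0 : 0 < x ^+ d by rewrite exprn_gt0 // (lt_le_trans _ x1).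
  rewrite ler_pdivlMr // mulrC ler_pdivrMr // natrX -exprMn.
  by rewrite lerXn2r // nnegrE mulr_ge0.
(* The bound is now K gamma^e = gamma^{1-eps} (K gamma^delta). *)
rewrite xd mulrA -/K eE gammaD mulrCA ler_piMr ?powR_ge0 //.
rewrite mulrC -ler_pdivlMr // div1r.
have Ki0 : 0 <= K^-1 by rewrite invr_ge0 ltW.
have -> : K^-1 = (K^-1 `^ delta^-1) `^ delta.
  by rewrite -powRrM mulVf ?gt_eqF // powRr1.
by apply: ge0_ler_powR; rewrite ?nnegrE ?powR_ge0 // ltW.
Qed.
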